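(* For any integers $n, k \geq 1$, the number $GD_{n,k}$ of generalized $(n,k)$-Dyck paths is $$GD_{n,k} = C_n^{(k)},$$ where $C_n^{(k)} = |J(T_{n,k})|$ is the number of lower ideals of the poset $T_{n,k}$.
   Context: Generalized Dyck paths: fix $n,k\ge 1$. A generalized $(n,k)$-Dyck path is a lattice path in the $n\times n$ square from $(0,0)$ to $(n,n)$, regarded as a sequence of steps, that stays weakly above the line $y=x$ and consists of vertical steps $N_k=(0,k)$, horizontal steps $E_k=(k,0)$, and diagonal steps $D_i=(i,i)$ for $1\le i\le k-1$. $GD_{n,k}$ denotes the number of such paths. Posets: for a set $S$ of positive integers, $P_S$ is the set of positive integers that cannot be written as a non-negative integer linear combination of elements of $S$, with the partial order generated by declaring $a$ above $b$ whenever $a-b\in S$ (equivalently, $b\le a$ in $P_S$ iff $a-b$ is a non-negative integer linear combination of elements of $S$). Write $T_{s,p}=P_{\{s,s+1,\dots,s+p\}}$. A lower ideal of a poset $P$ is a subset $I\subseteq P$ such that $a<_P b$ and $b\in I$ imply $a\in I$ (the empty set is allowed). $J(T_{s,p})$ is the set of all lower ideals of $T_{s,p}$. *)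

(* Defs.v *)
From HB Require Import structures.
From Stdlib Require Import Relation_Operators Operators_Properties.
From mathcomp Require Import all_boot all_order finmap.
From mathcomp Require Import boolp classical_sets cardinality.

Set Implicit Arguments.
Unset Strict Implicit.
Unset Printing Implicit Defensive.

Import Order.Theory.

Local Open Scope nat_scope.
Local Open Scope classical_set_scope.

(* A step is its displacement vector; for [0 < k] the listed steps are
   pairwise distinct, so a path is faithfully a sequence of vectors. *)
Definition step_N (k : nat) : nat * nat := (0, k).
Definition step_E (k : nat) : nat * nat := (k, 0).
Definition step_D (i : nat) : nat * nat := (i, i).

Definition gd_steps (k : nat) : seq (nat * nat) :=
  [:: step_N k, step_E k & [seq step_D i | i <- iota 1 k.-1]].

Definition move (q s : nat * nat) : nat * nat := (q.1 + s.1, q.2 + s.2).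

Definition vertices (p : seq (nat * nat)) : seq (nat * nat) :=
  (0, 0) :: scanl move (0, 0) p.

(* The square and the half-plane [y >= x] are convex, so it suffices to
   constrain the vertices of the path. *)
Definition is_gd_path (n k : nat) (p : seq (nat * nat)) : bool :=
  [&& all (mem (gd_steps k)) p,
      all (fun q => (q.1 <= n) && (q.2 <= n)) (vertices p),
      all (fun q => q.1 <= q.2) (vertices p) &
      last (0, 0) (vertices p) == (n, n)].

Definition gd_paths (n k : nat) : set (seq (nat * nat)) :=
  [set p | is_gd_path n k p].

(* [fset_set] is a junk value on infinite sets: the cardinals below are
   meaningful only together with finiteness of the set. *)
Definition GD (n k : nat) : nat := #|` fset_set (gd_paths n k)|.

Definition lincomb (S : set nat) (a : nat) : Prop :=
  exists (m : nat) (c s : 'I_m -> nat),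
    (forall i, S (s i)) /\ a = \sum_(i < m) c i * s i.

Definition gap (S : set nat) : pred nat :=
  fun a => (0 < a) && ~~ `[< lincomb S a >].

Record gap_poset (S : set nat) : Type :=
  Gap { gap_val :> nat; gap_valP : gap S gap_val }.

HB.instance Definition _ (S : set nat) := [isSub for @gap_val S].
HB.instance Definition _ (S : set nat) := [Choice of gap_poset S by <:].

Section GapOrder.
Variable S : set nat.
Implicit Types a b c : gap_poset S.

Definition gap_step b a : Prop := exists2 s, S s & gap_val a = gap_val b + s.

Definition gap_le : rel (gap_poset S) :=
  fun b a => `[< clos_refl_trans (gap_poset S) gap_step b a >].

Lemma gap_le_leq b a : gap_le b a -> gap_val b <= gap_val a.
Proof.
move=> /asboolP; elim=> [x y [s _ ->]|//|x y z _ + _]; first exact: leq_addr.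
exact: leq_trans.
Qed.

Lemma gap_le_refl : reflexive gap_le.
Proof. by move=> a; apply/asboolP; exact: rt_refl. Qed.

Lemma gap_le_anti : antisymmetric gap_le.
Proof.
move=> a b /andP[/gap_le_leq ab /gap_le_leq ba].
by apply/val_inj/eqP; rewrite eqn_leq; apply/andP; split.
Qed.

Lemma gap_le_trans : transitive gap_le.
Proof.
by move=> b a c /asboolP ab /asboolP bc; apply/asboolP; exact: rt_trans ab bc.
Qed.

End GapOrder.

Fact gap_display : Order.disp_t. Proof. exact: Order.Disp tt tt. Qed.

HB.instance Definition _ (S : set nat) :=
  Order.Le_isPOrder.Build gap_display (gap_poset S)
    (@gap_le_refl S) (@gap_le_anti S) (@gap_le_trans S).

Lemma lincomb_step (S : set nat) d s :
  lincomb S d -> S s -> lincomb S (d + s).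
Proof.
move=> [m [c [t [St ->]]]] Ss.
exists m.+1, (fun i => oapp c 1 (unlift ord_max i)),
  (fun i => oapp t s (unlift ord_max i)); split.
  by move=> i; case: (unlift _ i) => /=.
rewrite big_ord_recr /= unlift_none /= mul1n; congr (_ + _).
apply: eq_bigr => i _.
have -> : widen_ord (leqnSn m) i = lift ord_max i.
  by apply: val_inj; rewrite /= /bump leqNgt ltn_ord.
by rewrite liftK.
Qed.

Lemma lincomb_ind (S : set nat) (Q : nat -> Prop) :
  Q 0 -> (forall d s, lincomb S d -> Q d -> S s -> Q (d + s)) ->
  forall d, lincomb S d -> Q d.
Proof.
move=> Q0 QS d [m [c [t [St ->]]]].
suff : lincomb S (\sum_(i < m) c i * t i) /\ Q (\sum_(i < m) c i * t i).
  by case.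
have L0 : lincomb S 0.
  by exists 0, (fun _ => 0), (fun _ => 0); split; [case | rewrite big_ord0].
elim/big_rec: _ => [|i x _ Hx]; first by split.
elim: (c i) => [|k [IH1 IH2]]; first by rewrite mul0n add0n.
rewrite mulSn -addnA addnC; split; first exact: lincomb_step.
exact: QS.
Qed.

Lemma gap_leP (S : set nat) (b a : gap_poset S) :
  (b <= a)%O <->
  gap_val b <= gap_val a /\ lincomb S (gap_val a - gap_val b).
Proof.
have L0 : lincomb S 0.
  by exists 0, (fun _ => 0), (fun _ => 0); split; [case | rewrite big_ord0].
split=> [ba|[le_ba]].
  split; first exact: gap_le_leq.
  have : clos_refl_trans_n1 _ (@gap_step S) b a.
    by apply: clos_rt_rtn1; apply/asboolP.
  elim=> [|y z [s Ss ->] by_ IH]; first by rewrite subnn.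
  have yb : gap_val b <= gap_val y.
    by apply/gap_le_leq/asboolP/clos_rtn1_rt.
  by rewrite addnC -addnBA // addnC; exact: lincomb_step.
move=> Ld; move: (esym (subnKC le_ba)); move: Ld; move: (_ - _) => d Ld.
elim/lincomb_ind: Ld a {le_ba} => [|{}d s _ IH Ss] a Ea.
  by have -> : a = b; [apply: val_inj; rewrite /= Ea addn0 | exact: lexx].
have gy : gap S (gap_val b + d).
  have /andP[b0 _] := gap_valP b; have /andP[_ na] := gap_valP a.
  rewrite /gap (leq_trans b0 (leq_addr _ _)) /=; apply/negP => /asboolP Ly.
  by case/negP: na; apply/asboolP; rewrite Ea addnA; exact: lincomb_step.
apply: le_trans (IH (Gap gy) erefl) _.
by apply/asboolP; apply: rt_step; exists s => //=; rewrite Ea addnA.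
Qed.

Definition lower_ideal d (P : porderType d) (I : set P) : Prop :=
  forall a b : P, (a < b)%O -> I b -> I a.

Definition J d (P : porderType d) : set (set P) := [set I | lower_ideal I].
Arguments J {d} P _.

Definition T (s p : nat) : porderType gap_display :=
  gap_poset [set x | s <= x <= s + p].

Definition C (n k : nat) : nat := #|` fset_set (J (T n k))|.

(* Main.v *)
(* The gaps of {n, ..., n+k} are the a = d(n+k) + j with j > 0 and j + dk < n,
   and (d, j) is covered exactly by the (d+1, j') with j' <= j <= j' + k.  An
   ideal meets each column j in an initial segment; its heights h_1, ..., h_n
   satisfy h_n = 0 and h_i <= h_j + 1 for i <= j <= i + k, and every such
   sequence arises from one ideal.

   A path at height l k above the diagonal is turned into such a sequence:
   N_k writes nothing, E_k writes k - 1 times l and then l - 1, and D_i writes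
   i - 1 times l + 1 and then l.  The sequences written from level l are those
   whose first k - 1 entries are >= l and whose k-th entry is >= l - 1.  The
   first step can be read off: it is E_k iff the k-th entry is l - 1, it is D_i
   if the first entry <= l occurs at position i < k, and otherwise it is N_k. *)
Require Import Defs.
From Stdlib Require Import Relation_Operators.
From mathcomp Require Import all_boot all_order finmap zify.
From mathcomp Require Import boolp classical_sets cardinality.

Set Implicit Arguments.
Unset Strict Implicit.
Unset Printing Implicit Defensive.

Local Open Scope nat_scope.

(* The window size is [k = K + 1]; entries are numbered from 0. *)
Record admissible (K l : nat) (h : seq nat) : Prop := Admissible {
  admissible_last : last 0 h = 0;
  admissible_drop : forall i j, i <= j <= i + K.+1 -> j < size h ->
    nth 0 h i <= (nth 0 h j).+1;
  admissible_head : forall j, j < K -> j < size h -> l <= nth 0 h j;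
  admissible_next : K < size h -> l <= (nth 0 h K).+1;
  admissible_size : l * K.+1 <= size h }.

(** * Blocks: the words written by a single step [E_k] or [D_i] *)

Definition block (i b : nat) (h : seq nat) : seq nat := nseq i b.+1 ++ b :: h.

Lemma size_block i b h : size (block i b h) = i + (size h).+1.
Proof. by rewrite size_cat size_nseq. Qed.

Lemma nth_block_lt i b h j : j < i -> nth 0 (block i b h) j = b.+1.
Proof. by move=> ji; rewrite nth_cat size_nseq ji nth_nseq ji. Qed.

Lemma nth_block_eq i b h : nth 0 (block i b h) i = b.
Proof. by rewrite nth_cat size_nseq ltnn subnn. Qed.

Lemma nth_block_gt i b h j : i < j -> nth 0 (block i b h) j = nth 0 h (j - i.+1).
Proof.
move=> ij; rewrite nth_cat size_nseq ltnNge (ltnW ij) /=.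
by have -> : j - i = (j - i.+1).+1 by lia.
Qed.

Lemma block_nth i b (s : seq nat) : i < size s ->
  (forall j, j < i -> nth 0 s j = b.+1) -> nth 0 s i = b ->
  s = block i b (drop i.+1 s).
Proof.
move=> is_ lt_i eq_i; apply: (@eq_from_nth _ 0).
  by rewrite size_block size_drop; lia.
move=> j _; case: (ltngtP j i) => [ji|ij|->].
- by rewrite nth_block_lt // lt_i.
- by rewrite nth_block_gt // nth_drop subnKC.
- by rewrite nth_block_eq.
Qed.

Lemma block_inj i i' b h h' :
  block i b h = block i' b h' -> i = i' /\ h = h'.
Proof.
move=> e; have ii : i = i'.
  case: (ltngtP i i') => // lt_i; move: (congr1 (nth 0 ^~ (minn i i')) e) => /=.
    by rewrite (minn_idPl (ltnW lt_i)) nth_block_eq nth_block_lt // => /n_Sn.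
  rewrite (minn_idPr (ltnW lt_i)) nth_block_eq nth_block_lt //.
  by move/esym/n_Sn.
by split=> //; move/(congr1 (drop i.+1)): e; rewrite -ii !drop_cat size_nseq;
  rewrite ltnNge leqnSn /= subSnn /= !drop0.
Qed.

(** * Adding and removing a block *)

Section Profile.
Variable K : nat.

Lemma admissible_nil : admissible K 0 [::].
Proof. by split. Qed.

Lemma admissible_weaken l h : admissible K l.+1 h -> admissible K l h.
Proof.
case=> h0 hd hh hn hs; split=> // [j jK js|Ks|]; last by lia.
- by have := hh j jK js; lia.
- by have := hn Ks; lia.
Qed.

(** Level [b] of [h] gives the drop condition across the junction: the entries [b.+1] see only the
    first [K] entries of [h], and the closing [b] sees one more. The case [i = K] serves [E_k]. *)
Lemma admissible_block i b h l : admissible K b h -> i <= K ->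
  l <= b.+1 -> (i < K -> l <= b) -> admissible K l (block i b h).
Proof.
case=> h0 hd hh hn hs iK lb lbK; split.
- rewrite last_cat /=; case: h h0 {hd hh hn} hs => //= _ hs; nia.
- move=> u v /andP[uv vu]; rewrite size_block => vs.
  case: (ltngtP v i) => [vi|iv|vi].
  + rewrite !nth_block_lt //; lia.
  + rewrite (nth_block_gt _ _ iv); case: (ltngtP u i) => [ui|iu|ui].
    * rewrite nth_block_lt // ltnS; apply: hh; lia.
    * rewrite nth_block_gt //; apply: hd; lia.
    * rewrite ui nth_block_eq; case: (ltngtP (v - i.+1) K) => [vK|vK|vK].
      - by apply: leqW; apply: hh => //; lia.
      - by lia.
      - by rewrite vK; apply: hn; lia.
  + rewrite vi nth_block_eq; case: (ltngtP u i) => [ui||->]; try lia.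
      by rewrite nth_block_lt.
    by rewrite nth_block_eq.
- move=> j jK; rewrite size_block => js; case: (ltngtP j i) => [ji|ij|ji].
  + rewrite nth_block_lt //; lia.
  + rewrite nth_block_gt //; have := hh (j - i.+1); lia.
  + rewrite ji nth_block_eq; lia.
- rewrite size_block => Ks; case: (ltngtP K i) => [Ki|iK'|Ki]; first lia.
    by rewrite nth_block_gt //; have := hh (K - i.+1); lia.
  rewrite Ki nth_block_eq; lia.
- by rewrite size_block; case: (ltngtP i K) => iK'; nia.
Qed.

(** Each jump of [K.+1] positions loses at most one unit of height, and the last entry is 0. *)
Lemma admissible_bound l h c j : admissible K l h -> c < nth 0 h j ->
  j + c * K.+1 < (size h).-1.
Proof.
move=> ah; have [h0 hd _ _ _] := ah.
elim: c j => [|c IH] j cj.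
  have js : j < size h by rewrite ltnNge; apply/negP => /(nth_default 0) e; lia.
  case: (ltngtP j (size h).-1) => [||e]; try lia.
  by move: cj; rewrite e nth_last h0.
have js : j < size h by rewrite ltnNge; apply/negP => /(nth_default 0) e; lia.
(* Otherwise the last index, with entry 0, lies in the window of [j], and the entry at [j] is at
   most 1. *)
have jKs : j + K.+1 < size h.
  rewrite ltnNge; apply/negP => sj; have := @hd j (size h).-1.
  by rewrite nth_last h0; lia.
have := IH (j + K.+1); have := @hd j (j + K.+1); lia.
Qed.

(** Undoes [admissible_block]. Entry [K] of the tail is controlled by index [i], exactly [K.+1]
    positions earlier. *)
Lemma admissible_tail l h i b : admissible K l h -> i < size h ->
  nth 0 h i = b ->
  (forall j, j < K -> i.+1 + j < size h -> b <= nth 0 h (i.+1 + j)) ->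
  b * K.+1 < size h - i -> admissible K b (drop i.+1 h).
Proof.
case=> h0 hd _ _ _ is_ eq_i bh bs; split.
- have [e|si] := leqP (size h) i.+1; first by rewrite drop_oversize.
  rewrite -nth_last nth_drop size_drop.
  have -> : i.+1 + (size h - i.+1).-1 = (size h).-1 by lia.
  by rewrite nth_last.
- by move=> u v uv; rewrite size_drop !nth_drop => vs; apply: hd; lia.
- by move=> j jK; rewrite size_drop nth_drop => js; apply: bh; lia.
- by rewrite size_drop nth_drop => js; rewrite -eq_i; apply: hd; lia.
- by rewrite size_drop; lia.
Qed.

(* [climb l p]: the path [p] starts at height [l * K.+1] above the diagonal, ends
   on the diagonal and never goes below it. *)
Inductive climb : nat -> seq (nat * nat) -> Prop :=
| climb_nil : climb 0 [::]
| climb_N l p : climb l.+1 p -> climb l (step_N K.+1 :: p)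
| climb_E l p : climb l p -> climb l.+1 (step_E K.+1 :: p)
| climb_D l i p : i < K -> climb l p -> climb l (step_D i.+1 :: p).

(** Zero coordinates tell the three kinds of steps apart. On climbs [E_k] starts from a positive
    level, so [l.-1] does not truncate. *)
Fixpoint profile (l : nat) (p : seq (nat * nat)) : seq nat :=
  match p with
  | [::] => [::]
  | (0, _) :: p => profile l.+1 p
  | (i.+1, 0) :: p => block i l.-1 (profile l.-1 p)
  | (i.+1, _.+1) :: p => block i l (profile l p)
  end.

Lemma profile_admissible l p : climb l p -> admissible K l (profile l p).
Proof.
elim=> {l p} [|l p _ IH|l p _ IH|l i p iK _ IH] /=.
- exact: admissible_nil.
- exact: admissible_weaken.
- by apply: (admissible_block IH); lia.
- by apply: (admissible_block IH); lia.
Qed.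

Lemma size_profile l p : climb l p -> size (profile l p) = sumn (unzip1 p).
Proof.
elim=> {l p} [|l p _ IH|l p _ IH|l i p iK _ IH] //=.
- by rewrite size_block IH; lia.
- by rewrite size_block IH; lia.
Qed.

(** * Reading a path off an admissible sequence *)

Lemma climb_profile_surj l h : admissible K l h ->
  exists2 p, climb l p & profile l p = h.
Proof.
(* N_k keeps [h] and raises [l]; the other steps shorten [h] and lower [l] by at
   most one. *)
have [N] := ubnP (2 * size h - l); elim: N l h => // N IH l h sN ah.
have [h0 hd hh hn hs] := ah.
have [s0|s_gt0] := posnP (size h).
  move: hs; rewrite (size0nil s0) /= => hs; exists [::] => //.
  have -> : l = 0 by nia.
  exact: climb_nil.
have [/andP[Ks Kl]|KKs] := boolP ((K < size h) && (nth 0 h K < l)).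
  have lE : nth 0 h K = l.-1 by have := hn Ks; lia.
  have lt_K j : j < K -> nth 0 h j = l.-1.+1.
    by move=> jK; have := hh j jK; have := hd j K; lia.
  have ad : admissible K l.-1 (drop K.+1 h).
    apply: (admissible_tail ah) => // [j jK js|]; last by nia.
    (* Index [K.-1] carries height [l], and its window covers the first [K] entries of the tail. *)
    by have := hd K.-1 (K.+1 + j); have := lt_K K.-1; lia.
  have [|p cp ep] := IH _ _ _ ad; first by rewrite size_drop; nia.
  exists (step_E K.+1 :: p).
    by rewrite -(ltn_predK Kl); exact: climb_E.
  by rewrite /= ep -block_nth.
have Kh : K < size h -> l <= nth 0 h K by move: KKs; case: ltnP => //=; lia.
pose i := find (fun x => x <= l) h.
have i_size : i < size h.
  rewrite -has_find; apply/hasP; exists (last 0 h); last by rewrite h0.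
  by rewrite -nth_last mem_nth // prednK.
have le_i : nth 0 h i <= l by apply: (@nth_find _ 0 (fun x => x <= l)); rewrite has_find.
have lt_i j : j < i -> l < nth 0 h j.
  by move=> ji; rewrite ltnNge (@before_find _ 0 (fun x => x <= l)).
have bound c j : c < nth 0 h j -> j + c * K.+1 < (size h).-1 := admissible_bound ah.
have [iK|Ki] := ltnP i K.
  have eq_i : nth 0 h i = l by have := hh i iK i_size; lia.
  have lt_iE j : j < i -> nth 0 h j = l.+1.
    by move=> ji; have := lt_i j ji; have := hd j i; lia.
  have ad : admissible K l (drop i.+1 h).
    apply: (admissible_tail ah) => // [j jK js|].
      have [jiK|jiK|jiK] := ltngtP (i.+1 + j) K.
      - exact: hh.
      - by have := hd i.-1 (i.+1 + j); have := lt_i i.-1; lia.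
      - by rewrite jiK in js *; exact: Kh.
    (* For positive [l], the strict size bound comes from a high entry: at index [K] if [i = 0], at
       index [i.-1] otherwise. *)
    have [i0|i_gt0] := posnP i.
      have [l0|l_gt0] := posnP l; first by lia.
      by have := bound l.-1 K; have := Kh; nia.
    by have := bound l i.-1; have := lt_i i.-1; lia.
  have [|p cp ep] := IH _ _ _ ad; first by rewrite size_drop; nia.
  exists (step_D i.+1 :: p); first exact: climb_D.
  by rewrite /= ep -block_nth.
have Ks : K < size h by lia.
(* The first [K] entries exceed [l], so [h] itself serves one level up, after [N_k]. *)
have ad : admissible K l.+1 h.
  split=> // [j jK _|]; first by apply: lt_i; lia.
  have [K0|K_gt0] := posnP K.
    have [l0|l_gt0] := posnP l; first by lia.
    by have := bound l.-1 K; have := Kh; nia.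
  by have := bound l K.-1; have := lt_i K.-1; lia.
(* The size condition keeps [2 * size h - l] positive, so raising [l] does lower it. *)
have [|p cp ep] := IH _ _ _ ad; first by have := admissible_size ad; nia.
by exists (step_N K.+1 :: p) => //; exact: climb_N.
Qed.

(** * Injectivity: different first steps write different sequences *)

Lemma climb_inv l p : climb l p ->
  [\/ l = 0 /\ p = [::],
      exists2 q, p = step_N K.+1 :: q & climb l.+1 q,
      exists b q, [/\ l = b.+1, p = step_E K.+1 :: q & climb b q] |
      exists i q, [/\ i < K, p = step_D i.+1 :: q & climb l q]].
Proof.
case=> {l p} [|l p cp|l p cp|l i p iK cp].
- exact: Or41.
- by apply: Or42; exists p.
- by apply: Or43; exists l, p.
- by apply: Or44; exists i, p.
Qed.

Lemma profile_N_neq_nil l p : climb l.+1 p -> profile l.+1 p <> [::].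
Proof. by move=> /profile_admissible/admissible_size + e; rewrite e mulSn. Qed.

Lemma block_neq_nil i b h : block i b h <> [::].
Proof. by move/(congr1 size); rewrite size_block /=; lia. Qed.

(** From level [l.+1], [E_k] writes [l] at index [K]; one level up, where [N_k] leads, that entry is
    at least [l.+1]. *)
Lemma profile_N_neq_E l p q : climb l.+2 p ->
  profile l.+2 p <> block K l (profile l q).
Proof.
move=> /profile_admissible/admissible_next + e; rewrite e size_block nth_block_eq.
by lia.
Qed.

Lemma profile_N_neq_D l i p q : i < K -> climb l.+1 p ->
  profile l.+1 p <> block i l (profile l q).
Proof.
move=> iK /profile_admissible/admissible_head/(_ i iK) + e.
by rewrite e size_block nth_block_eq; lia.
Qed.

(** [E_k] puts [l] at index [K]; after the diagonal step that index falls among the first [K]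
    entries of the tail, which are at least [l.+1]. *)
Lemma profile_E_neq_D l i p q : i < K -> climb l.+1 q ->
  block K l (profile l p) <> block i l.+1 (profile l.+1 q).
Proof.
move=> iK /profile_admissible aq /(congr1 (nth 0 ^~ K)) /=.
rewrite nth_block_eq nth_block_gt // => e.
by have := admissible_head aq (j := K - i.+1); have := admissible_size aq; nia.
Qed.

Lemma profile_inj l p q :
  climb l p -> climb l q -> profile l p = profile l q -> p = q.
Proof.
move=> cp; elim: cp q => {l p} [|l p cp IH|l p cp IH|l i p iK cp IH] q /climb_inv[].
- by case=> _ ->.
- by case=> q' -> cq /esym/(profile_N_neq_nil cq).
- by case=> b [q' [//]].
- by case=> i [q' [_ -> _]] /esym/block_neq_nil.
- by case=> l0 -> /=; move: cp; rewrite l0 => /profile_N_neq_nil.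
- by case=> q' -> cq /= /(IH _ cq) ->.
- by case=> b [q' [lb -> _]]; move: cp; rewrite lb /= => cp /(profile_N_neq_E cp).
- by case=> i [q' [iK -> cq]] /= /(profile_N_neq_D iK cp).
- by case.
- by case=> q' -> cq /esym/(profile_N_neq_E cq).
- by case=> b [q' [[<-] -> cq]] /= /block_inj[_ /(IH _ cq) ->].
- by case=> i [q' [iK -> cq]] /= /(profile_E_neq_D iK cq).
- by case=> _ -> /block_neq_nil.
- by case=> q' -> cq /esym/(profile_N_neq_D iK cq).
- case=> b [q' [lb -> _]]; move: cp; rewrite lb /= => cp.
  by move/esym/(profile_E_neq_D iK cp).
- by case=> j [q' [jK -> cq]] /= /block_inj[-> /(IH _ cq) ->].
Qed.

(** * Climbs and the definition of paths by vertices *)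

Lemma mem_gd_steps s : s \in gd_steps K.+1 ->
  [\/ s = step_N K.+1, s = step_E K.+1 | exists2 i, i < K & s = step_D i.+1].
Proof.
rewrite !inE => /or3P[/eqP->|/eqP->|/mapP[i]]; first exact: Or31.
  exact: Or32.
rewrite mem_iota => iK ->; apply: Or33; exists i.-1; first by lia.
by rewrite prednK //; lia.
Qed.

(** Steps change the height above the diagonal by 0 or [K.+1], so staying weakly above it means that
    the level remains a natural number. *)
Lemma climb_scanP l x p :
  climb l p <->
  [/\ all (mem (gd_steps K.+1)) p,
      all (fun q => q.1 <= q.2) (scanl move (x, x + l * K.+1) p) &
      (last (x, x + l * K.+1) (scanl move (x, x + l * K.+1) p)).1 =
      (last (x, x + l * K.+1) (scanl move (x, x + l * K.+1) p)).2].
Proof.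
have stepN y m : move (y, y + m * K.+1) (step_N K.+1) = (y, y + m.+1 * K.+1).
  by rewrite /move /= mulSn; congr pair; lia.
have stepE y m : move (y, y + m.+1 * K.+1) (step_E K.+1) =
    (y + K.+1, y + K.+1 + m * K.+1).
  by rewrite /move /= mulSn; congr pair; lia.
have stepD i y m : move (y, y + m * K.+1) (step_D i) = (y + i, y + i + m * K.+1).
  by rewrite /move /=; congr pair; lia.
split=> [cp|].
  elim: cp x => {l p} [|l p _ IH|l p _ IH|l i p iK _ IH] x.
  - by rewrite /= addn0.
  - have [? ? ?] := IH x; rewrite [scanl _ _ _]/= stepN /=; split=> //.
      by rewrite !inE eqxx.
    by apply/andP; split=> //; lia.
  - have [? ? ?] := IH (x + K.+1); rewrite [scanl _ _ _]/= stepE /=; split=> //.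
      by rewrite !inE eqxx orbT.
    by apply/andP; split=> //; lia.
  - have [? ? ?] := IH (x + i.+1); rewrite [scanl _ _ _]/= stepD /=; split=> //.
      rewrite !inE; apply/andP; split=> //; apply/or3P/Or33/map_f.
      by rewrite mem_iota; lia.
    by apply/andP; split=> //; lia.
elim: p l x => [|s p IH] l x.
  case=> _ _ /= e; have -> : l = 0 by nia.
  exact: climb_nil.
case=> /andP[/mem_gd_steps sk pk]; case: sk => [->|->|[i iK ->]].
- rewrite [scanl _ _ _]/= stepN => /andP[_ ap] lp.
  by apply: climb_N; apply: (IH _ x); split.
- case: l => [|l]; first by rewrite /= /move /= => /andP[]; lia.
  rewrite [scanl _ _ _]/= stepE => /andP[_ ap] lp.
  by apply: climb_E; apply: (IH _ (x + K.+1)); split.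
- rewrite [scanl _ _ _]/= stepD => /andP[_ ap] lp.
  by apply: climb_D => //; apply: (IH _ (x + i.+1)); split.
Qed.

Lemma last_scan_move (q : nat * nat) p :
  (last q (scanl move q p)).1 = q.1 + sumn (unzip1 p).
Proof.
elim: p q => [|s p IH] q /=; first by rewrite addn0.
by rewrite IH /= addnA.
Qed.

(** Coordinates never decrease along a path, so the endpoint alone keeps it in the square. *)
Lemma all_le_last_scan_move (q : nat * nat) p :
  all (fun v => (v.1 <= (last q (scanl move q p)).1) &&
                (v.2 <= (last q (scanl move q p)).2)) (q :: scanl move q p).
Proof.
elim: p q => [|s p IH] q /=; first by rewrite !leqnn.
move: (IH (move q s)) => /= /andP[/andP[h1 h2] ->]; rewrite h1 h2 !andbT.
by rewrite (leq_trans _ h1) ?(leq_trans _ h2) ?leq_addr.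
Qed.

Lemma is_gd_pathP n p :
  is_gd_path n K.+1 p <-> climb 0 p /\ sumn (unzip1 p) = n.
Proof.
have l1 : (last (0, 0) (scanl move (0, 0) p)).1 = sumn (unzip1 p).
  by rewrite last_scan_move.
have := climb_scanP 0 0 p.
have := all_le_last_scan_move (0, 0) p.
rewrite mul0n addn0 /is_gd_path /vertices [last _ (_ :: _)]/= => le_last cP.
rewrite -l1; split.
  by case/and4P=> ps _ /andP[_ pd] /eqP e; split; [apply/cP; rewrite e|rewrite e].
case=> /cP[ps pd e1] en; rewrite ps /= pd.
have e : last (0, 0) (scanl move (0, 0) p) = (n, n).
  by apply/eqP; rewrite -pair_eqE /pair_eq /= -e1 en eqxx.
by move: le_last; rewrite e /= eqxx andbT.
Qed.

End Profile.

(** * Lower ideals as admissible sequences *)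

Section Ideals.
Variables n K : nat.
Hypothesis n_gt0 : 0 < n.

Local Notation k := K.+1.
Local Notation S := [set x | n <= x <= n + k]%classic.

(** Sums of [m] consecutive-range generators fill an interval. *)
Lemma lincombP a : lincomb S a <-> exists m, m * n <= a <= m * (n + k).
Proof.
split=> [|[m]].
  elim/lincomb_ind => [|d s _ [m hm] /= hs]; first by exists 0.
  by exists m.+1; rewrite !mulSn; lia.
elim: m a => [|m IH] a.
  rewrite !mul0n => a0; have -> : a = 0 by lia.
  by exists 0, (fun=> 0), (fun=> 0); split; [case|rewrite big_ord0].
rewrite !mulSn => am.
(* Greedy choice: the largest generator that leaves at least [m * n]. *)
pose s := minn (a - m * n) (n + k).
have -> : a = (a - s) + s by rewrite /s; lia.
by apply: lincomb_step => /=; [apply: IH|]; rewrite /s; nia.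
Qed.

(** The gaps in row [d] lie strictly between the end [d * (n + k)] of one interval of sums and the
    start [d.+1 * n] of the next. *)
Lemma gapP d j : j < n + k -> gap S (d * (n + k) + j) <-> 0 < j /\ j + d * k < n.
Proof.
move=> jnk; rewrite /gap; split.
  move=> /andP[a0 /asboolPn na]; rewrite !lt0n; split.
    by apply/eqP => j0; apply: na; apply/lincombP; exists d; rewrite j0; nia.
  rewrite ltnNge; apply/negP => nj; apply: na; apply/lincombP; exists d.+1.
  by rewrite !mulSn; nia.
case=> j0 jd; apply/andP; split; first by lia.
apply/asboolPn => /lincombP[m /andP[h1 h2]].
have [md|dm] := leqP m d; first by nia.
by have := leq_mul dm (leqnn n); rewrite mulSn; nia.
Qed.

Definition row (a : nat) := a %/ (n + k).
Definition col (a : nat) := a %% (n + k).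

Lemma row_col (a : gap_poset S) :
  [/\ gap_val a = row a * (n + k) + col a, 0 < col a & col a + row a * k < n].
Proof.
have e := divn_eq (gap_val a) (n + k); split; first exact: e.
  have := gap_valP a; rewrite {1}e => /gapP[] //; rewrite ltn_mod; lia.
have := gap_valP a; rewrite {1}e => /gapP[] //; rewrite ltn_mod; lia.
Qed.

Lemma row_colD d j : j < n -> row (d * (n + k) + j) = d /\ col (d * (n + k) + j) = j.
Proof.
move=> jn; rewrite /row /col divnMDl; last by lia.
by rewrite modnMDl divn_small ?modn_small ?addn0 //; lia.
Qed.

(* [h] lists the heights of columns 1 to n, hence the shift of index. *)
Definition ideal_of (h : seq nat) : set (T n k) :=
  [set a : T n k | row (gap_val a) < nth 0 h (col (gap_val a)).-1]%classic.

Lemma ideal_of_lower h : admissible K 0 h -> size h = n -> lower_ideal (ideal_of h).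
Proof.
move=> ah sh a b /Order.POrderTheory.ltW /asboolP.
elim=> {a b} [a b [s /= ns ab]|//|a c b _ IHa _ IHb]; last by move/IHb/IHa.
rewrite /ideal_of /=.
have [ea a0 an] := row_col a; have [eb b0 bn] := row_col b.
(* Columns lie strictly between 0 and [n], so adding a generator moves up exactly one row. *)
have rb : row b = (row a).+1.
  case: (ltngtP (row b) (row a).+1) => // hr.
    by nia.
  by nia.
have cc : col b <= col a <= col b + k by rewrite ea eb rb mulSn in ab; lia.
move=> hb; have := admissible_drop ah (i := (col b).-1) (j := (col a).-1).
rewrite sh; lia.
Qed.

(** By [admissible_bound] every cell below the heights is a genuine gap, so the ideal determines the
    heights. *)
Lemma ideal_ofP h d j : admissible K 0 h -> size h = n -> j < n ->
  d < nth 0 h j <->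
  exists2 a : T n k, gap_val a = d * (n + k) + j.+1 & ideal_of h a.
Proof.
move=> ah sh jn; split=> [dj|[a ea]].
  have := admissible_bound ah dj; rewrite sh => bj.
  have ga : gap S (d * (n + k) + j.+1) by apply/gapP; lia.
  exists (Gap ga) => //; rewrite /ideal_of /=.
  have [|-> -> //] := @row_colD d j.+1; lia.
have jnk : j.+1 < n + k by lia.
have [_ jd] : 0 < j.+1 /\ j.+1 + d * k < n by apply/(gapP d jnk); rewrite -ea gap_valP.
rewrite /ideal_of /= ea; have [|-> -> //] := @row_colD d j.+1; lia.
Qed.

Lemma ideal_of_inj h h' : admissible K 0 h -> size h = n ->
  admissible K 0 h' -> size h' = n -> ideal_of h = ideal_of h' -> h = h'.
Proof.
move=> ah sh ah' sh' e; apply: (@eq_from_nth _ 0) => [|j]; first by rewrite sh.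
rewrite sh => jn.
by apply/eqP; rewrite eqn_leq; apply/andP; split; rewrite leqNgt; apply/negP;
  [move/(ideal_ofP _ ah sh jn); rewrite e => /(ideal_ofP _ ah' sh' jn)
  |move/(ideal_ofP _ ah' sh' jn); rewrite -e => /(ideal_ofP _ ah sh jn)];
  rewrite ltnn.
Qed.

Lemma ideal_of_surj (I : set (T n k)) : lower_ideal I ->
  exists h, [/\ admissible K 0 h, size h = n & ideal_of h = I].
Proof.
move=> lI.
pose P j d := `[< exists2 a : T n k, gap_val a = d * (n + k) + j.+1 & I a >].
have Pn j d : j < n -> P j d -> j.+1 + d * k < n.
  by move=> jn /asboolP[a ea _]; have := gap_valP a; rewrite ea => /gapP[] //; lia.
have Pd i j d : i <= j <= i + k -> i < n -> P i d.+1 -> P j d.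
  move=> ij ltin Pid; have ltj := Pn _ _ ltin Pid.
  case/asboolP: Pid => a ea Ia; apply/asboolP.
  have gb : gap S (d * (n + k) + j.+1) by apply/gapP; lia.
  exists (Gap gb : T n k) => //; apply: (lI _ a) => //.
  rewrite Order.POrderTheory.lt_def; apply/andP; split.
    apply/eqP => /(congr1 (@gap_val _)) /=; rewrite ea mulSn; lia.
  (* The witness is the difference of the two elements; [j <= i + k] makes it at least [n]. *)
  apply/asboolP/rt_step; exists (n + k + i - j) => /=; first by lia.
  by rewrite ea mulSn; lia.
have Ple j d e : j < n -> e <= d -> P j d -> P j e.
  move=> jn; elim: d => [|d IH]; first by rewrite leqn0 => /eqP ->.
  rewrite leq_eqVlt => /orP[/eqP-> //|ed] /Pd-/(_ j) Pjd; apply: IH => //.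
  by apply: Pjd => //; lia.
(* The height is the first row missing from the column. Searching below [n] suffices, since [P j d]
   forces [d < n]. *)
pose h := mkseq (fun j => find (predC (P j)) (iota 0 n)) n.
have sh : size h = n by rewrite size_mkseq.
have hP j d : j < n -> (d < nth 0 h j) = P j d.
  move=> jn; rewrite nth_mkseq //; apply/idP/idP => [dh|Pjd].
    have dn : d < n by rewrite (leq_trans dh) // -[leqRHS](size_iota 0) find_size.
    by have := before_find 0 dh; rewrite /= nth_iota // add0n => /negbFE.
  rewrite ltnNge; apply/negP => fd.
  have dn : d < n by have := Pn _ _ jn Pjd; lia.
  have hasP : has (predC (P j)) (iota 0 n) by rewrite has_find size_iota; lia.
  have := nth_find 0 hasP; rewrite /= nth_iota ?add0n; last by lia.
  by rewrite (Ple _ _ _ jn fd Pjd).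
have ah : admissible K 0 h.
  split=> // [|i j ij]; rewrite ?sh.
    (* Column [n] contains no gap, so its height is 0. *)
    rewrite -nth_last sh; apply/eqP; rewrite -leqn0 leqNgt hP; last by lia.
    by apply/negP => /Pn; lia.
  move=> jn; rewrite leqNgt; apply/negP; rewrite hP => [Pij|]; last by lia.
  have : P j (nth 0 h j) by apply: (Pd i) => //; lia.
  by rewrite -hP // ltnn.
exists h; split=> //; apply/seteqP; split=> a.
  rewrite /ideal_of /=; have [ea a0 an] := row_col a.
  rewrite hP; last by lia.
  case/asboolP=> b eb; suff -> : a = b by [].
  by apply: val_inj; rewrite /= eb prednK // -ea.
move=> Ia; rewrite /ideal_of /=; have [ea a0 an] := row_col a.
rewrite hP; last by lia.
by apply/asboolP; exists a => //; rewrite prednK.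
Qed.

End Ideals.

(** * Finiteness and the final count *)

Lemma finite_admissible n K :
  finite_set [set h | admissible K 0 h /\ size h = n]%classic.
Proof.
pose f (t : n.-tuple 'I_n.+1) : seq nat := map val t.
apply: (@sub_finite_set _ _ (f @` setT)%classic); last first.
  exact/finite_image/finite_finset.
move=> h [ah sh] /=.
have h_le j : nth 0 h j < n.+1.
  (* By [admissible_bound], an entry [c.+1] has [c < n]. *)
  case e : (nth 0 h j) => [//|c]; have := @admissible_bound K 0 h c j ah.
  by rewrite e sh; nia.
exists [tuple Ordinal (h_le i) | i < n] => //; rewrite /f /= -map_comp.
apply: (@eq_from_nth _ 0) => [|j]; rewrite size_map size_enum_ord ?sh // => jn.
by rewrite (nth_map (Ordinal jn)) ?size_enum_ord //= nth_enum_ord.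
Qed.

Theorem theorem4p1 (n k : nat) (hn : (0 < n)%N) (hk : (0 < k)%N) :
  [/\ finite_set (gd_paths n k), finite_set (J (T n k)) & GD n k = C n k].
Proof.
case: k hk => // K _.
pose phi p := @ideal_of n K (profile 0 p).
have gd_climb p : gd_paths n K.+1 p -> climb K 0 p /\ size (profile 0 p) = n.
  by move=> /is_gd_pathP[cp <-]; split=> //; exact: size_profile cp.
have J_image : (J (T n K.+1) = phi @` gd_paths n K.+1)%classic.
  apply/seteqP; split=> [I /(ideal_of_surj hn)[h [ah sh <-]]|_ [p /gd_climb[cp sp] <-]].
    have [p cp ep] := climb_profile_surj ah; exists p; last by rewrite /phi ep.
    by apply/is_gd_pathP; split=> //; rewrite -(size_profile cp) ep.
  by apply: ideal_of_lower => //; exact: profile_admissible.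
have finJ : finite_set (J (T n K.+1)).
  apply: sub_finite_set (finite_image (@ideal_of n K) (finite_admissible n K)).
  by move=> I /(ideal_of_surj hn)[h [ah sh <-]]; exists h.
have eq_card : (J (T n K.+1) #= gd_paths n K.+1)%card.
  rewrite J_image; apply: inj_card_eq => p q /set_mem/gd_climb[cp sp].
  move=> /set_mem/gd_climb[cq sq] /ideal_of_inj e.
  by apply: (profile_inj cp cq); apply: e => //; exact: profile_admissible.
(* Finiteness passes from ideals to paths, so both [fset_set] cardinals are genuine. *)
have finGD : finite_set (gd_paths n K.+1) by rewrite -(eq_finite_set eq_card).
by split=> //; apply/esym/fcard_eq.
Qed.
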